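(* Let $R$ be a ring with a ring endomorphism $\alpha:R\to R$. Then the skew formal power series ring $R[[x,\alpha]]$ is UnitUC if and only if $R$ is UnitUC.
   Context: Rings are associative with $1\neq 0$; ring endomorphisms preserve $1$; $U(R)$ is the group of units, $Id(R)$ the set of idempotents of $R$. $R[[x,\alpha]]$ is the ring of all formal power series $\sum_{i\ge 0}a_ix^i$ with $a_i\in R$, with multiplication determined by $xr=\alpha(r)x$ for all $r\in R$. A ring $R$ is clean if every $a\in R$ can be written as $a=e+u$ with $e\in Id(R)$, $u\in U(R)$. For $e,f\in Id(R)$ write $e\sim f$ if there is $u\in U(R)$ with $e=u^{-1}fu$. $R$ is unit uniquely clean (UnitUC) if it is clean and, whenever $e+u=f+v$ with $e,f\in Id(R)$ and $u,v\in U(R)$, one has $e\sim f$. *)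

(* Defs.v *)
From HB Require Import structures.
From mathcomp Require Import all_boot all_algebra.
From mathcomp Require Import boolp.

Set Implicit Arguments.
Unset Strict Implicit.
Unset Printing Implicit Defensive.

Import GRing.Theory.
Local Open Scope ring_scope.

Section UnitUC.
Variable R : nzRingType.
Implicit Types a e f u v w : R.

Definition idempotent_elt e := e * e = e.

(* Two-sided invertibility, as a proposition: [GRing.unit] would require the
   rings to come with a computed inverse ([unitRingType]). *)
Definition inverses u w := u * w = 1 /\ w * u = 1.
Definition invertible u := exists w, inverses u w.

Definition clean_ring :=
  forall a, exists e u, [/\ idempotent_elt e, invertible u & a = e + u].

(* [w] is the inverse of [u], so the last equation is e = u^-1 f u. *)
Definition unit_conj e f := exists u w, inverses u w /\ e = w * f * u.

Definition UnitUC :=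
  clean_ring /\
  forall e f u v,
    idempotent_elt e -> idempotent_elt f -> invertible u -> invertible v ->
    e + u = f + v -> unit_conj e f.

End UnitUC.

(* The parameter [alpha] only indexes the type, so that the ring structure
   found by inference is the one twisted by [alpha]. *)
Record skew_series (R : nzRingType) (alpha : {rmorphism R -> R}) :=
  SkewSeries { scoef : nat -> R }.

Arguments SkewSeries {R} alpha _.

(* Equality and choice are classical: a power series is an infinite object. *)
HB.instance Definition _ R alpha := gen_eqMixin (@skew_series R alpha).
HB.instance Definition _ R alpha := gen_choiceMixin (@skew_series R alpha).

Section SkewSeriesRing.
Variables (R : nzRingType) (alpha : {rmorphism R -> R}).
Local Notation S := (skew_series alpha).
Implicit Types (p q r : S) (a b : R) (n : nat).

Lemma skew_seriesP p q : (forall n, scoef p n = scoef q n) -> p = q.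
Proof.
by case: p q => [f] [g] /= fg; congr SkewSeries; apply/funext.
Qed.

Definition skew0 : S := SkewSeries alpha (fun=> 0).
Definition skew_opp p : S := SkewSeries alpha (fun n => - scoef p n).
Definition skew_add p q : S :=
  SkewSeries alpha (fun n => scoef p n + scoef q n).
Definition skewC a : S := SkewSeries alpha (fun n => if n is 0 then a else 0).
Definition skewX : S := SkewSeries alpha (fun n => (n == 1)%:R).

(* From x r = alpha(r) x one gets
   (a x^i) (b x^j) = a alpha^i(b) x^(i + j). *)
Definition skew_mul p q : S :=
  SkewSeries alpha (fun n =>
    \sum_(i < n.+1) scoef p i * iter i alpha (scoef q (n - i))).

Fact skew_addA : associative skew_add.
Proof. by move=> p q r; apply: skew_seriesP => n /=; rewrite addrA. Qed.

Fact skew_addC : commutative skew_add.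
Proof. by move=> p q; apply: skew_seriesP => n /=; rewrite addrC. Qed.

Fact skew_add0 : left_id skew0 skew_add.
Proof. by move=> p; apply: skew_seriesP => n /=; rewrite add0r. Qed.

Fact skew_addN : left_inverse skew0 skew_opp skew_add.
Proof. by move=> p; apply: skew_seriesP => n /=; rewrite addNr. Qed.

HB.instance Definition _ :=
  GRing.isZmodule.Build S skew_addA skew_addC skew_add0 skew_addN.

Lemma iter_rmorph0 n : iter n alpha 0 = 0.
Proof. by elim: n => //= n ->; rewrite rmorph0. Qed.

Lemma iter_rmorph1 n : iter n alpha 1 = 1.
Proof. by elim: n => //= n ->; rewrite rmorph1. Qed.

Lemma iter_rmorphD n a b : iter n alpha (a + b) = iter n alpha a + iter n alpha b.
Proof. by elim: n => //= n ->; rewrite rmorphD. Qed.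

Lemma iter_rmorphM n a b : iter n alpha (a * b) = iter n alpha a * iter n alpha b.
Proof. by elim: n => //= n ->; rewrite rmorphM. Qed.

Lemma iter_rmorph_sum n (I : Type) (s : seq I) (P : pred I) (F : I -> R) :
  iter n alpha (\sum_(i <- s | P i) F i) =
  \sum_(i <- s | P i) iter n alpha (F i).
Proof. exact: (big_morph _ (iter_rmorphD n) (iter_rmorph0 n)). Qed.

Fact skew_mulA : associative skew_mul.
Proof.
move=> p q r; apply: skew_seriesP => n /=.
pose c3 j k := scoef p j * (iter j alpha (scoef q (k - j)) *
                            iter k alpha (scoef r (n - k))).
transitivity (\sum_(j < n.+1) \sum_(k < n.+1 | (j <= k)%N) c3 j k).
  apply: eq_bigr => -[j /= ltjn] _.
  rewrite iter_rmorph_sum big_distrr /=.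
  rewrite -(big_mkord (leq j) (c3 j)) /=.
  rewrite (@big_cat_nat _ _ _ j) //=; last exact: ltnW.
  rewrite big_nat_cond [X in _ = X + _]big1 ?add0r; last first.
    by move=> k /andP[ltkj /(leq_trans ltkj)]; rewrite ltnn.
  rewrite -[X in \sum_(X <= _ < _ | _) _]add0n big_addn subSn // big_mkord /=.
  apply: eq_big => [i | i _]; first by rewrite leq_addl.
  rewrite /c3 iter_rmorphM addnK.
  by rewrite -iterD -subnDA (addnC i j).
rewrite (exchange_big_dep predT) //=; apply: eq_bigr => -[k /= ltkn] _.
rewrite (big_ord_narrow_leq (ltkn : (k <= n)%N)) big_distrl /=.
by apply: eq_bigr => j _; rewrite /c3 mulrA.
Qed.

Fact skew_mul1 : left_id (skewC 1) skew_mul.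
Proof.
move=> p; apply: skew_seriesP => n /=.
by rewrite big_ord_recl big1 ?addr0 ?mul1r ?subn0 // => i _; rewrite mul0r.
Qed.

Fact skew_mulr1 : right_id (skewC 1) skew_mul.
Proof.
move=> p; apply: skew_seriesP => n /=.
rewrite big_ord_recr /= subnn iter_rmorph1 mulr1 big1 ?add0r // => i _ /=.
by rewrite -(subnSK (ltn_ord i)) /= iter_rmorph0 mulr0.
Qed.

Fact skew_mulDl : left_distributive skew_mul +%R.
Proof.
move=> p q r; apply: skew_seriesP => n /=; rewrite -big_split /=.
by apply: eq_bigr => i _; rewrite mulrDl.
Qed.

Fact skew_mulDr : right_distributive skew_mul +%R.
Proof.
move=> p q r; apply: skew_seriesP => n /=; rewrite -big_split /=.
by apply: eq_bigr => i _; rewrite iter_rmorphD mulrDr.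
Qed.

Fact skew1_neq0 : skewC 1 != 0.
Proof.
by apply/eqP => /(congr1 (fun p => scoef p 0)) /= /eqP; rewrite oner_eq0.
Qed.

HB.instance Definition _ :=
  GRing.Zmodule_isNzRing.Build S
    skew_mulA skew_mul1 skew_mulr1 skew_mulDl skew_mulDr skew1_neq0.

Lemma scoefM p q n :
  scoef (p * q) n = \sum_(i < n.+1) scoef p i * iter i alpha (scoef q (n - i)).
Proof. by []. Qed.

Lemma scoefMX p n : scoef (p * skewX) n = if n is m.+1 then scoef p m else 0.
Proof.
case: n => [|n]; rewrite scoefM.
  by rewrite big_ord_recl big_ord0 /= mulr0 addr0.
rewrite big_ord_recr big_ord_recr /= subnn subSnn iter_rmorph0 iter_rmorph1.
rewrite rmorph0 mulr0 addr0 mulr1 big1 ?add0r // => i _ /=.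
have lt_in := ltn_ord i.
by rewrite subSn 1?ltnW // eqSS subn_eq0 leqNgt lt_in iter_rmorph0 mulr0.
Qed.

Lemma skewXC a : skewX * skewC a = skewC (alpha a) * skewX.
Proof.
apply: skew_seriesP => n; rewrite scoefMX scoefM; case: n => [|n].
  by rewrite big_ord_recl big_ord0 /= mul0r addr0.
rewrite big_ord_recl big_ord_recl /= mul0r add0r mul1r /bump /= subSS subn0.
rewrite big1 ?addr0; first by case: n => //=; rewrite rmorph0.
by move=> i _; rewrite mul0r.
Qed.

Lemma scoefCXn a m n : scoef (skewC a * skewX ^+ m) n = if n == m then a else 0.
Proof.
elim: m n => [|m IHm] n; first by rewrite expr0 mulr1; case: n.
by rewrite exprSr mulrA scoefMX; case: n => [|n] //; rewrite IHm.
Qed.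

End SkewSeriesRing.

(* Main.v *)
Require Import Defs.
From mathcomp Require Import all_boot all_algebra.

(** Taking constant coefficients is a ring morphism from R[[x,alpha]] onto R,
    split by the constant series. It reflects invertibility, since 1 - y has
    the inverse 1 + y + y^2 + ... when y has no constant term. Clean
    decompositions thus pass in both directions. For the uniqueness of the
    idempotent, after a conjugation by a constant one is left with two
    idempotents e, f with the same constant term; then e f + (1 - e)(1 - f)
    has constant term 1, hence is a unit, and it intertwines e and f. *)

Set Implicit Arguments.
Unset Strict Implicit.
Unset Printing Implicit Defensive.

Import GRing.Theory.
Local Open Scope ring_scope.

Section Invertible.
Variable R : nzRingType.
Implicit Types e f g t u v w : R.

(** The two one-sided inverses coincide: [w = v * u * w = v]. *)
Lemma invertible_lr u v w : v * u = 1 -> u * w = 1 -> invertible u.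
Proof.
move=> vu uw; exists w; split=> //.
by rewrite -[w]mul1r -vu -[v * u * w]mulrA uw mulr1.
Qed.

Lemma idempotent_conj u w f :
  inverses u w -> idempotent_elt f -> idempotent_elt (w * f * u).
Proof.
move=> [uw _] ff; rewrite /idempotent_elt !mulrA.
by rewrite -[w * f * u * w]mulrA uw mulr1 -[w * f * f]mulrA ff.
Qed.

Lemma unit_conj_trans e f g : unit_conj e f -> unit_conj f g -> unit_conj e g.
Proof.
move=> [u [w [[uw wu] ->]]] [v [z [[vz zv] ->]]].
exists (v * u), (w * z); split; last by rewrite !mulrA.
split; first by rewrite mulrA -[v * u * w]mulrA uw mulr1.
by rewrite mulrA -[w * z * v]mulrA zv mulr1.
Qed.

Lemma unit_conj_intertwine e f t :
  invertible t -> e * t = t * f -> unit_conj e f.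
Proof.
move=> [s [ts st]] et; exists s, t; split; first by split.
by rewrite -et -mulrA ts mulr1.
Qed.

(** Both sides collapse to [e * f], since [e * (1 - e) = 0] and [(1 - f) * f = 0]. *)
Lemma idempotent_intertwine e f :
    idempotent_elt e -> idempotent_elt f ->
  let t := e * f + (1 - e) * (1 - f) in e * t = t * f.
Proof.
move=> ee ff /=.
have eNe : e * (1 - e) = 0 by rewrite mulrBr mulr1 ee subrr.
have fNf : (1 - f) * f = 0 by rewrite mulrBl mul1r ff subrr.
rewrite [LHS]mulrDr [RHS]mulrDl !mulrA ee eNe mul0r.
by rewrite -!mulrA ff fNf mulr0.
Qed.

End Invertible.

Section SkewSeries.
Variables (R : nzRingType) (alpha : {rmorphism R -> R}).
Local Notation S := (skew_series alpha).
Local Notation C := (skewC alpha).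
Implicit Types (p q y u : S) (a b e f : R).

Lemma scoefD p q n : scoef (p + q) n = scoef p n + scoef q n.
Proof. by []. Qed.

Lemma scoefB p q n : scoef (p - q) n = scoef p n - scoef q n.
Proof. by []. Qed.

Lemma scoef_sum (I : Type) (s : seq I) (P : pred I) (F : I -> S) n :
  scoef (\sum_(i <- s | P i) F i) n = \sum_(i <- s | P i) scoef (F i) n.
Proof. exact: (big_morph (fun p : S => scoef p n) (fun _ _ => erefl) erefl). Qed.

Lemma scoef0M p q : scoef (p * q) 0 = scoef p 0 * scoef q 0.
Proof. by rewrite scoefM big_ord1. Qed.

Lemma skewCD : {morph C : a b / a + b}.
Proof. by move=> a b; apply: skew_seriesP => -[|n] //=; rewrite addr0. Qed.

Lemma skewCM : {morph C : a b / a * b}.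
Proof.
move=> a b; apply: skew_seriesP => -[|n]; first by rewrite scoef0M.
rewrite scoefM big_ord_recl /= mulr0 add0r big1 // => i _.
by rewrite mul0r.
Qed.

(** This locality of the product lets a factor be truncated when a single coefficient is
    computed. *)
Lemma eq_scoefM p p' q q' n :
    (forall i, (i <= n)%N -> scoef p i = scoef p' i) ->
    (forall i, (i <= n)%N -> scoef q i = scoef q' i) ->
  scoef (p * q) n = scoef (p' * q') n.
Proof.
move=> pp' qq'; rewrite !scoefM; apply: eq_bigr => i _.
by rewrite pp' ?qq' ?leq_subr // -ltnS.
Qed.

Lemma scoefX_small y k n : scoef y 0 = 0 -> (n < k)%N -> scoef (y ^+ k) n = 0.
Proof.
move=> y0; elim: k n => // k IHk n; rewrite ltnS => le_nk.
(* The term with index 0 dies with [scoef y 0]; every other term takes a coefficient of [y ^+ k] of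
   index below [n]. *)
rewrite exprS scoefM big_ord_recl y0 mul0r add0r big1 // => i _.
rewrite IHk ?iter_rmorph0 ?mulr0 //=.
by apply: leq_trans le_nk; rewrite /bump add1n subnSK ?leq_subr.
Qed.

(** The infinite sum of the powers of [y], cut off separately for each coefficient: if [y] has no
    constant term, powers beyond [n] do not reach coefficient [n]. *)
Definition skew_geom y : S :=
  SkewSeries alpha (fun n => scoef (\sum_(k < n.+1) y ^+ k) n).

(** A single partial sum thus serves for all coefficients up to [m], as a product requires. *)
Lemma scoef_geom y m n : scoef y 0 = 0 -> (n <= m)%N ->
  scoef (skew_geom y) n = scoef (\sum_(k < m.+1) y ^+ k) n.
Proof.
move=> y0 le_nm; rewrite /= !scoef_sum.
rewrite (big_ord_widen m.+1 (fun k => scoef (y ^+ k) n)) // big_mkcond /=.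
apply: eq_bigr => k _; case: ltnP => // lt_nk.
by rewrite scoefX_small.
Qed.

Lemma geom_inverses y : scoef y 0 = 0 -> inverses (1 - y) (skew_geom y).
Proof.
move=> y0; have geomE n := fun i => @scoef_geom y n i y0.
have tele n : (1 - y) * (\sum_(k < n.+1) y ^+ k) = 1 - y ^+ n.+1.
  by rewrite -opprB mulNr -subrX1 opprB.
(* Commutation transfers the telescoping identity to the product in the other order. *)
have comm n : GRing.comm (1 - y) (\sum_(k < n.+1) y ^+ k).
  apply: commr_sum => k _; apply/commr_sym/commrB; first exact: commr1.
  exact/commr_sym/commrX.
split; apply: skew_seriesP => n.
  rewrite (eq_scoefM (fun i _ => erefl) (geomE n)) tele.
  by rewrite scoefB scoefX_small // subr0.
rewrite (eq_scoefM (geomE n) (fun i _ => erefl)) -comm tele.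
by rewrite scoefB scoefX_small // subr0.
Qed.

Lemma invertible_scoef0_1 u : scoef u 0 = 1 -> invertible u.
Proof.
move=> u1; exists (skew_geom (1 - u)); rewrite -{1}[u](subKr 1).
by apply: geom_inverses; rewrite scoefB u1 subrr.
Qed.

Lemma invertible_skew u : invertible u <-> invertible (scoef u 0).
Proof.
split=> [[w [uw wu]]|[w [uw wu]]].
  by exists (scoef w 0); split; rewrite -scoef0M ?uw ?wu.
(* Both [C w * u] and [u * C w] have constant term 1; their inverses give [u] a left inverse
   [z * C w] and a right inverse [C w * s]. *)
have [|z [_ zwu]] := @invertible_scoef0_1 (C w * u); first by rewrite scoef0M.
have [|s [uws _]] := @invertible_scoef0_1 (u * C w); first by rewrite scoef0M.
by apply: (@invertible_lr _ u (z * C w) (C w * s)); rewrite -?mulrA // mulrA.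
Qed.

Lemma idempotent_scoef0 p : idempotent_elt p -> idempotent_elt (scoef p 0).
Proof. by rewrite /idempotent_elt -scoef0M => ->. Qed.

Lemma idempotent_skewC e : idempotent_elt e -> idempotent_elt (C e).
Proof. by rewrite /idempotent_elt -skewCM => ->. Qed.

Lemma unit_conj_scoef0_eq p q :
    idempotent_elt p -> idempotent_elt q -> scoef p 0 = scoef q 0 ->
  unit_conj p q.
Proof.
move=> pp qq pq0; apply: unit_conj_intertwine (idempotent_intertwine pp qq).
have ee := idempotent_scoef0 qq.
(* For the common constant term [e], this is [e * e + (1 - e) * (1 - e) = 1]. *)
apply: invertible_scoef0_1; rewrite scoefD !scoef0M !scoefB pq0 ee.
by rewrite mulrBr mulr1 mulrBl mul1r ee subrr subr0 addrC subrK.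
Qed.

Lemma unit_conj_scoef0 p q :
    idempotent_elt p -> idempotent_elt q ->
  unit_conj p q <-> unit_conj (scoef p 0) (scoef q 0).
Proof.
move=> pp qq; split=> [[u [w [[uw wu] ->]]]|[u [w [[uw wu] pq]]]].
  exists (scoef u 0), (scoef w 0); split; last by rewrite !scoef0M.
  by split; rewrite -scoef0M ?uw ?wu.
have inv_uw : inverses (C u) (C w) by split; rewrite -skewCM ?uw ?wu.
(* The constant conjugate of [q] has the constant term [w * scoef q 0 * u], which is that of [p]. *)
apply: (@unit_conj_trans _ _ (C w * q * C u)); last by exists (C u), (C w).
apply: unit_conj_scoef0_eq => //; first exact: idempotent_conj.
by rewrite !scoef0M.
Qed.

End SkewSeries.

Theorem proposition2p13 (R : nzRingType) (alpha : {rmorphism R -> R}) :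
  UnitUC (skew_series alpha) <-> UnitUC R.
Proof.
split=> -[clean uniq]; split.
- move=> a; have [p [u [pp uu aE]]] := clean (skewC alpha a).
  exists (scoef p 0), (scoef u 0); split.
  + exact: idempotent_scoef0.
  + exact/invertible_skew.
  + by rewrite -scoefD -aE.
- move=> e f u v ee ff uu vv efE.
  have eeC := idempotent_skewC alpha ee; have ffC := idempotent_skewC alpha ff.
  (* The equation is lifted to constant series, and the conjugacy found there descends to constant
     terms. *)
  apply/(unit_conj_scoef0 eeC ffC)/(uniq _ _ (skewC alpha u) (skewC alpha v)) => //.
  + exact/invertible_skew.
  + exact/invertible_skew.
  + by rewrite -!skewCD efE.
- move=> p; have [e [u [ee uu pE]]] := clean (scoef p 0).
  (* All higher coefficients of [p] go into the unit part, whose constant term is [u]. *)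
  exists (skewC alpha e), (p - skewC alpha e); split.
  + exact: idempotent_skewC.
  + by apply/invertible_skew; rewrite scoefB pE /= [e + u]addrC addrK.
  + by rewrite addrC subrK.
- move=> p q u v pp qq uu vv pqE; apply/unit_conj_scoef0 => //.
  apply: (uniq _ _ (scoef u 0) (scoef v 0)).
  + exact: idempotent_scoef0.
  + exact: idempotent_scoef0.
  + exact/invertible_skew.
  + exact/invertible_skew.
  + by rewrite -!scoefD pqE.
Qed.
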